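(* Let $2\le a<b$ be integers and let $\mathfrak T$ be a tree in the class $\Upsilon_{a,b}$. Assume that there exist positive constants $\alpha$, $c_1$ and $c_2$ such that $$c_1\,\alpha^r\le |S_r(x)|\le c_2\,\alpha^r\qquad\text{for all } x\in\mathfrak T \text{ and all } r\in\mathbb N .$$ Then the centred Hardy--Littlewood maximal operator $\mathcal M$ on $\mathfrak T$ is of weak type $(1,1)$.
   Context: A tree is a connected graph with no loops (cycles), identified with its set of vertices; $\nu(x)$ is the number of neighbours of the vertex $x$. For integers $a\le b$, $\Upsilon_{a,b}$ is the class of all trees such that $a+1\le\nu(x)\le b+1$ for every vertex $x$, with both values $a+1$ and $b+1$ attained. A tree carries the graph distance $d$ and the counting measure $\mu$; $|E|:=\mu(E)$, $S_r(x):=\{y:d(x,y)=r\}$ and $B_r(x):=\{y: d(x,y)\le r\}$. With $\mathbb N=\{0,1,2,\dots\}$, $$\mathcal M f(x):=\sup_{r\in\mathbb N}\frac1{|B_r(x)|}\int_{B_r(x)}|f|\,d\mu .$$ Weak type $(1,1)$ means that there is a constant $C$ such that $|\{x\in\mathfrak T:\mathcal M f(x)>\lambda\}|\le C\lambda^{-1}\|f\|_{L^1(\mathfrak T)}$ for all $\lambda>0$ and all $f\in L^1(\mathfrak T)$ (with respect to the counting measure). *)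

(* Defs.v *)
From HB Require Import structures.
From mathcomp Require Import all_boot all_order all_algebra.
From mathcomp Require Import finmap.
From mathcomp Require Import all_classical all_reals all_analysis.

Set Implicit Arguments.
Unset Strict Implicit.
Unset Printing Implicit Defensive.

Import Order.TTheory GRing.Theory Num.Theory.
Local Open Scope classical_set_scope.
Local Open Scope ring_scope.

(* A graph is a relation [e] on a nonempty vertex type [V]; adjacency is
   boolean-valued, which is no restriction classically. *)
Section Graph.
Context {V : pointedType}.
Implicit Types (e : rel V) (x y : V) (r n : nat).

Definition walk e n x y : Prop :=
  exists p : seq V, [/\ path e x p, last x p = y & size p = n].

Definition is_connected e : Prop := forall x y, exists n, walk e n x y.

(* [ucycle e c] also holds for lists [c] of length at most 2, for which it
   expresses no genuine cycle. *)
Definition is_acyclic e : Prop :=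
  forall c : seq V, (2 < size c)%N -> ~ ucycle e c.

Definition is_tree e : Prop :=
  [/\ symmetric e, irreflexive e, is_connected e & is_acyclic e].

(* The value 0 on pairs not joined by a walk is a dummy. *)
Definition gdist e x y : nat :=
  if pselect (exists n, `[< walk e n x y >]) is left h then ex_minn h else 0%N.

Definition gsphere e x r : set V := [set y | gdist e x y = r].

Definition gball e x r : set V := [set y | (gdist e x y <= r)%N].

Definition neighbours e x : set V := [set y | e x y].

(* Meaningful only at vertices with finitely many neighbours, since [fset_set]
   sends infinite sets to the empty one. *)
Definition valence e x : nat := #|` fset_set (neighbours e x)|.

Definition Upsilon (a b : nat) e : Prop :=
  [/\ is_tree e,
      forall x, finite_set (neighbours e x),
      forall x, (a.+1 <= valence e x <= b.+1)%N,
      exists x, valence e x = a.+1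
    & exists x, valence e x = b.+1].

End Graph.

(* [V] with the sigma-algebra of all its subsets. *)
Definition discrete (V : Type) : Type := V.

HB.instance Definition _ (V : pointedType) := Pointed.on (discrete V).
HB.instance Definition _ (V : pointedType) :=
  @isMeasurable.Build default_measure_display (discrete V)
    discrete_measurable discrete_measurable0
    (@discrete_measurableC V) (@discrete_measurableU V).

Section Maximal.
Context (R : realType) {V : pointedType}.
Local Open Scope ereal_scope.

Definition mu : {measure set (discrete V) -> \bar R} := counting.

Definition maximal (e : rel V) (f : V -> R) (x : V) : \bar R :=
  ereal_sup (range (fun r : nat =>
    (mu (gball e x r))^-1 * \int[mu]_(y in gball e x r) `|f y|%:E)).

Definition weak_type11 (T : (V -> R) -> V -> \bar R) : Prop :=
  exists C : R, forall (f : V -> R) (lambda : R),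
    mu.-integrable [set: discrete V] (EFin \o f) -> (0 < lambda)%R ->
    mu [set x | lambda%:E < T f x] <= (C / lambda)%:E * \int[mu]_y `|f y|%:E.

End Maximal.

(* Main.v *)
Require Import Defs.
From mathcomp Require Import all_boot all_order all_algebra.
From mathcomp Require Import finmap.
From mathcomp Require Import all_classical all_reals all_analysis.
From mathcomp Require Import zify ring lra.
Import Order.TTheory GRing.Theory Num.Theory.
Local Open Scope classical_set_scope.
Local Open Scope ring_scope.

Set Implicit Arguments.
Unset Strict Implicit.
Unset Printing Implicit Defensive.

(** The maximal inequality is obtained by a direct charging argument, in the
spirit of the combinatorial proof of Naor and Tao for regular trees.

A tree can be rooted: there is a parent map such that every edge joins a vertex
to its parent ([tree_parent]). A shortest path of length [k] climbs [k - p] steps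
and then descends [p] steps ([gdist_peak]). Once [k] and [p] are fixed, a source
[x] has at most [c2 * alpha ^+ p] targets [y], because they lie on a sphere of
radius [p] about an ancestor of [x]; and a target [y] has at most
[c2 * alpha ^+ (k - p)] sources. The upper bound on spheres replaces
homogeneity here. All vertices have at least three neighbours, so spheres grow
at least like [2 ^ r] ([sphere_growth]) and [alpha > 1]. Geometric sums in
[alpha] then make averages over balls controlled by the quantities
[alpha ^- k * \sum_(y | d x y = k) `|f y|] ([maximal_gt_sphere], where the lower
bound on spheres enters).

The core is [weak_type_charging]. Let [F] be a finite set of points [x], each
having some [k] such that the sum of [h] over the sphere of radius [k] about [x]
exceeds [alpha ^+ k]. Split the targets according to whether [h y] is below or
above [c * alpha ^+ (k - 2 * p)]. Counting targets, the light ones contribute at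
most half of [alpha ^+ k]. Hence the heavy ones, with weights
[min 1 (2 * h y / alpha ^+ k)], add up to at least 1. Summing over [x] and
counting sources bounds the size of [F] by a sum over [y], [k] and [p] of the
heavy weights times [alpha ^+ (k - p)], which for each [y] is at most a constant
times [h y] ([sum_heavy_le]). The exponent [k - 2 * p] balances the two counts:
a larger share of heavy pairs is allowed as the descent gets longer, when each
[y] has few sources.

Only finite subsets of the level set have to be bounded ([mu_le_seq]), and
finitely many balls are contained in a finite set, so all sums and exchanges of
summation are finite. *)

(** * Walks and distances *)

Section Walks.
Context {V : pointedType}.
Implicit Types (e : rel V) (x y z : V) (m n r : nat).

Lemma walk0 e x : walk e 0 x x.
Proof. by exists [::]. Qed.

Lemma walk1 e x y : e x y -> walk e 1 x y.
Proof. by move=> exy; exists [:: y]; rewrite /= andbT. Qed.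

Lemma walk_trans e m n x y z :
  walk e m x y -> walk e n y z -> walk e (m + n) x z.
Proof.
move=> [p [ep <- <-]] [q [eq <- <-]].
by exists (p ++ q); rewrite cat_path ep eq last_cat size_cat.
Qed.

Lemma walk_sym e n x y : symmetric e -> walk e n x y -> walk e n y x.
Proof.
move=> sym_e [p [ep <- <-]]; exists (rev (belast x p)); split.
- by rewrite rev_path (eq_path (e' := e)) // => u v; rewrite sym_e.
- by case: p {ep} => //= z p; rewrite rev_cons last_rcons.
- by rewrite size_rev size_belast.
Qed.

Lemma walkS_split e n x y :
  walk e n.+1 x y -> exists2 z, e x z & walk e n z y.
Proof.
move=> [[|z p] [] //= /andP[exz ep] lp [sp]]; exists z => //.
by exists p.
Qed.

Lemma gdist_le e n x y : walk e n x y -> (gdist e x y <= n)%N.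
Proof.
move=> w; rewrite /gdist; case: pselect => [h|//].
by case: ex_minnP => m _; apply; exact/asboolP.
Qed.

Lemma gdist_walk e x y : is_connected e -> walk e (gdist e x y) x y.
Proof.
move=> con; rewrite /gdist; case: pselect => [h|[]].
  by case: ex_minnP => m /asboolP.
by have [n w] := con x y; exists n; exact/asboolP.
Qed.

Lemma gdist_eq0 e x y : is_connected e -> gdist e x y = 0%N -> x = y.
Proof.
move=> /gdist_walk - /(_ x y) + d0; rewrite d0 => -[[|z p] [] //].
Qed.

End Walks.

(** * Parent maps on a tree *)

Section ParentMap.
Context {V : pointedType}.
Variables (e : rel V).
Hypothesis treeE : is_tree e.

Let symE : symmetric e. Proof. by case: treeE. Qed.
Let irrE : irreflexive e. Proof. by case: treeE. Qed.
Let conE : is_connected e. Proof. by case: treeE. Qed.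
Let acyE : is_acyclic e. Proof. by case: treeE. Qed.

(** The second vertex of a shortest walk from [x] to the root [o]. *)
Lemma closer_neighbour (o x : V) : exists x' : V,
  (x = o -> x' = o) /\
  (x <> o -> e x x' /\ gdist e o x = (gdist e o x').+1).
Proof.
have [->|xo] := pselect (x = o); first by exists o.
have wxo : walk e (gdist e o x) x o by apply: walk_sym => //; exact: gdist_walk.
case d : (gdist e o x) => [|n].
  by case: xo; rewrite (gdist_eq0 conE d).
move: wxo; rewrite d => /walkS_split[z exz wzo].
exists z; split => // _; split=> //.
have le1 : (gdist e o z <= n)%N by apply: gdist_le; apply: walk_sym.
have : (gdist e o x <= gdist e o z + 1)%N.
  apply: gdist_le; apply: walk_trans; first exact: gdist_walk.
  by apply: walk1; rewrite symE.
rewrite d; lia.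
Qed.

Lemma path_traject (pi : V -> V) x n :
  (forall z, pi z = z \/ e z (pi z)) ->
  (forall m, (m < n)%N -> iter m.+1 pi x <> iter m pi x) ->
  path e x (traject pi (pi x) n).
Proof.
move=> step; elim: n x => //= n IH x ne.
have -> /= : e x (pi x) by case: (step x) => // E; case: (ne 0%N).
by apply: IH => m lt; rewrite -!iterSr; apply: ne.
Qed.

Lemma uniq_traject_min (pi : V -> V) x n :
  (forall i j, (i < j)%N -> (j <= n)%N -> iter i pi x <> iter j pi x) ->
  uniq (traject pi x n.+1).
Proof.
move=> inj; apply/(uniqP x) => i j; rewrite !inE size_traject => ilt jlt.
rewrite !nth_traject //.
have [ij|ij|->] := ltngtP i j; move=> // E; exfalso.
  by apply: (inj _ _ ij _ E); lia.
by apply: (inj _ _ ij _ (esym E)); lia.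
Qed.

(** This is the only use of acyclicity. Iterating [pi] from both ends of an
edge leads to [o], so the two ascending sequences meet; take the meeting with
the fewest steps [i + j] in total. Minimality makes the vertices before the
meeting pairwise distinct, so closing the two branches with the edge [x y]
gives a simple cycle with [i + j + 1] vertices. This forces [i + j <= 1], and
then one end is the parent of the other. *)
Lemma edge_parent (o : V) (pi : V -> V) :
  (forall x, pi x = x \/ e x (pi x)) ->
  (forall x, exists n, iter n pi x = o) ->
  forall x y, e x y -> pi x = y \/ pi y = x.
Proof.
move=> step root x y exy.
pose P n := `[< exists i j, (i + j = n)%N /\ iter i pi x = iter j pi y >].
have exP : exists n, P n.
  have [i Ei] := root x; have [j Ej] := root y.
  by exists (i + j)%N; apply/asboolP; exists i, j; rewrite Ei Ej.
case: (ex_minnP exP) => n /asboolP[i [j [ijn Eij]]] minn.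
have coll a b : iter a pi x = iter b pi y -> (i + j <= a + b)%N.
  by move=> E; rewrite ijn; apply: minn; apply/asboolP; exists a, b.
have injx a b : (a < b)%N -> (b <= i)%N -> iter a pi x <> iter b pi x.
  move=> ab bi E.
  have := coll (i - b + a)%N j; rewrite iterD E -iterD subnK // Eij.
  by move=> /(_ erefl); lia.
have injy a b : (a < b)%N -> (b <= j)%N -> iter a pi y <> iter b pi y.
  move=> ab bj E.
  have := coll i (j - b + a)%N; rewrite iterD E -iterD subnK // Eij.
  by move=> /(_ erefl); lia.
have [ij0|ij0] := eqVneq (i + j)%N 0%N.
  have [i0 j0] : i = 0%N /\ j = 0%N by lia.
  by move: Eij exy; rewrite i0 j0 /= => ->; rewrite irrE.
have [ij1|ij1] := eqVneq (i + j)%N 1%N.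
  have [[i1 j0]|[i0 j1]] : (i = 1 /\ j = 0)%N \/ (i = 0 /\ j = 1)%N by lia.
    by left; move: Eij; rewrite i1 j0.
  by right; move: Eij; rewrite i0 j1.
exfalso; apply: (acyE (c := traject pi x i.+1 ++ rev (traject pi y j))).
  by rewrite size_cat size_rev !size_traject; lia.
apply/andP; split.
  rewrite [traject pi x _]/= /cycle cat_cons rcons_cat cat_path; apply/andP; split.
    apply: path_traject => // m mi E.
    by apply: (injx m m.+1) => //; rewrite E.
  rewrite last_traject Eij.
  have -> : rcons (rev (traject pi y j)) x =
            rev (belast x (traject pi y j.+1)).
    by rewrite trajectSr belast_rcons rev_cons.
  have {1}-> : iter j pi y = last x (traject pi y j.+1).
    by rewrite trajectSr last_rcons.
  rewrite rev_path (eq_path (e' := e)) => [|u v]; last by rewrite symE.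
  rewrite /= exy; apply: path_traject => // m mj E.
  by apply: (injy m m.+1) => //; rewrite E.
rewrite cat_uniq rev_uniq; apply/and3P; split.
- exact: uniq_traject_min.
- apply/hasPn => z; rewrite mem_rev => /trajectP[b bj ->].
  by apply/negP => /trajectP[a ai /esym/coll]; lia.
- case: j injy {ijn Eij coll ij0 ij1} => // j injy.
  by apply: uniq_traject_min => a b ab bj; apply: injy => //; lia.
Qed.

(** With [o] its own parent, [iter m pi] is defined for all [m] and moves a
vertex by at most [m], with no condition on its depth; this keeps the
confluence argument below free of case distinctions at the root. *)
Lemma tree_parent (o : V) : exists pi : V -> V,
  [/\ forall x, pi x = x \/ e x (pi x),
      forall x y, e x y -> pi x = y \/ pi y = x,
      pi o = o
    & forall x, x <> o -> gdist e o x = (gdist e o (pi x)).+1].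
Proof.
have /choice [pi Hpi] : forall x, exists x' : V, (x = o -> x' = o) /\
    (x <> o -> e x x' /\ gdist e o x = (gdist e o x').+1).
  exact: closer_neighbour.
have pio : pi o = o by case: (Hpi o) => ->.
have step x : pi x = x \/ e x (pi x).
  by have [->|/(proj2 (Hpi x))[]] := pselect (x = o); [left|right].
exists pi; split => //; last by move=> x /(proj2 (Hpi x))[].
apply: (edge_parent (o := o)) => // x.
have [n] := ubnP (gdist e o x); elim: n x => // n IH x lt.
have [->|/(proj2 (Hpi x))[_ d]] := pselect (x = o); first by exists 0%N.
have [|m Em] := IH (pi x); first by lia.
by exists m.+1; rewrite iterSr.
Qed.

(** At most one of the three or more neighbours of [x] is its parent. *)
Lemma two_children (pi : V -> V) :
  (forall x y, e x y -> pi x = y \/ pi y = x) ->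
  (forall x, finite_set (neighbours e x)) ->
  (forall x, (2 < valence e x)%N) ->
  forall x, exists yz : V * V,
    [/\ yz.1 <> yz.2, e x yz.1 /\ pi yz.1 = x & e x yz.2 /\ pi yz.2 = x].
Proof.
move=> orient fin val x; have := val x; rewrite /valence.
set A := fset_set _; have memA y : y \in A = e x y.
  by rewrite in_fset_set //; apply/idP/idP; rewrite inE.
rewrite (cardfsD1 (pi x)); set B := (A `\ pi x)%fset => cardB.
have memB y : y \in B -> e x y /\ pi y = x.
  rewrite in_fsetD1 memA => /andP[/eqP ne exy]; split => //.
  by case: (orient _ _ exy) => // E; case: ne.
have : (1 < size (enum_fset B))%N.
  by move: cardB; case: (pi x \in A) => /=; lia.
have memE y : y \in enum_fset B -> e x y /\ pi y = x by exact: memB.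
have := fset_uniq B; case: (enum_fset B) memE => [|y [|z s]] //= memE.
rewrite inE negb_or => /andP[/andP[/eqP yz _] _] _.
by exists (y, z); split => //=; apply: memE; rewrite !inE eqxx ?orbT.
Qed.

(** Two children at each vertex double the sphere about the root at each step.
This serves to show that the growth rate exceeds 1. *)
Lemma sphere_growth (o : V) :
  (forall x, finite_set (neighbours e x)) ->
  (forall x, (2 < valence e x)%N) ->
  forall r, exists s : seq V,
    [/\ uniq s, size s = (2 ^ r)%N & forall y, y \in s -> gdist e o y = r].
Proof.
move=> fin val; have [pi [_ orient pio up]] := tree_parent o.
have /choice[c Hc] := two_children orient fin val.
have dist x y : e x y -> pi y = x -> gdist e o y = (gdist e o x).+1.
  move=> exy pyx; rewrite -pyx; apply: up => yo.
  by move: exy; rewrite -pyx yo pio irrE.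
elim=> [|r [s [us ss ds]]].
  exists [:: o]; split => // y; rewrite inE => /eqP ->.
  by apply/eqP; rewrite -leqn0; apply: gdist_le; exact: walk0.
exists (map (fun x => (c x).1) s ++ map (fun x => (c x).2) s); split.
- rewrite cat_uniq !map_inj_uniq ?us /=; first last.
  + by move=> x y E; have [_ [_ <-] _] := Hc x; have [_ [_ <-] _] := Hc y; rewrite E.
  + by move=> x y E; have [_ _ [_ <-]] := Hc x; have [_ _ [_ <-]] := Hc y; rewrite E.
  rewrite andbT; apply/hasPn => z /mapP[x _ ->]; apply/negP => /mapP[y _ E].
  have [ne _ [_ px]] := Hc x; have [_ [_ py] _] := Hc y.
  by case: ne; rewrite E; have -> : x = y by rewrite -py -E px.
- by rewrite size_cat !size_map ss expnS mul2n addnn.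
- move=> y; rewrite mem_cat => /orP[] /mapP[x xs ->].
  + by have [_ [ex px] _] := Hc x; rewrite (dist _ _ ex px) ds.
  + by have [_ _ [ex px]] := Hc x; rewrite (dist _ _ ex px) ds.
Qed.

Section Confluence.
Variable pi : V -> V.
Hypothesis step : forall x, pi x = x \/ e x (pi x).
Hypothesis orient : forall x y, e x y -> pi x = y \/ pi y = x.

Lemma walk_iter m x : exists2 n, (n <= m)%N & walk e n x (iter m pi x).
Proof.
elim: m => [|m [n le w]]; first by exists 0%N => //; exact: walk0.
case: (step (iter m pi x)) => [E|E].
  by exists n; [exact: leqW|rewrite /= E].
exists n.+1 => //; rewrite -addn1; apply: walk_trans w _; exact: walk1.
Qed.

(** A walk can be replaced by an ascent followed by a descent that is no
longer: a step down followed by a step up returns to where it started. *)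
Lemma walk_peak n x y : walk e n x y ->
  exists m p, (m + p <= n)%N /\ iter m pi x = iter p pi y.
Proof.
elim: n x => [|n IH] x.
  by move=> [[|? ?] [] //= _ -> _]; exists 0%N, 0%N.
move=> /walkS_split[x' exx' /IH[m [p [le E]]]].
case: (orient exx') => [px|px'].
  by exists m.+1, p; split; [lia|rewrite iterSr px].
case: m le E => [|m] le E.
  by exists 0%N, p.+1; split; [lia|rewrite /= -E].
by exists m, p; split; [lia|rewrite -px' -iterSr].
Qed.

(** On a shortest walk neither the ascent nor the descent can be shortened, so
the two distances to the peak are exact. The pair is thus located by the
descent length [p]: given [x], the target [y] lies on one sphere of radius [p],
and given [y], the source [x] lies on one sphere of radius [k - p]. *)
Lemma gdist_peak x y k : gdist e x y = k -> exists2 p, (p <= k)%N &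
  gdist e (iter (k - p) pi x) y = p /\ gdist e (iter p pi y) x = (k - p)%N.
Proof.
move=> dk; have := gdist_walk x y conE; rewrite dk => /walk_peak[m [p [le E]]].
have [m' m'le wm] := walk_iter m x; have [p' p'le wp] := walk_iter p y.
have tri a b : walk e a x (iter m pi x) -> walk e b y (iter p pi y) ->
    (k <= a + b)%N.
  move=> wa wb; rewrite -dk; apply: gdist_le; apply: walk_trans wa _.
  by rewrite E; apply: walk_sym.
have kmp : k = (m + p)%N by have := tri _ _ wm wp; lia.
exists p; first by lia.
have -> : (k - p = m)%N by lia.
set z := iter m pi x in E wm tri *; rewrite -E.
have dx : (gdist e z x <= m')%N by apply: gdist_le; apply: walk_sym.
have dy : (gdist e z y <= p')%N.
  by apply: gdist_le; apply: walk_sym => //; rewrite E.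
have := tri _ _ (walk_sym symE (gdist_walk z x conE)).
rewrite -E => /(_ _ (walk_sym symE (gdist_walk z y conE))); lia.
Qed.

End Confluence.
End ParentMap.

(** * The counting measure through finite sequences *)

Section CountingMeasure.
Context (R : realType) {V : pointedType}.
Implicit Types (A : set V) (s : seq V).
Local Open Scope ereal_scope.

Lemma seq_size_le_mu s A : uniq s -> (forall y, y \in s -> A y) ->
  (size s)%:R%:E <= mu R A.
Proof.
move=> us sA; rewrite /mu /= /counting; case: ifPn => [/asboolP finA|_].
  rewrite lee_fin ler_nat; apply: (@uniq_leq_size _ s (fset_set A)) => // y ys.
  by rewrite in_fset_set // inE; exact: sA.
exact: leey.
Qed.

(** An infinite set contains finite sets of every size, which forces
[K = +oo]. *)
Lemma mu_le_seq A (K : \bar R) :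
  (forall s, uniq s -> (forall y, y \in s -> A y) -> (size s)%:R%:E <= K) ->
  mu R A <= K.
Proof.
move=> H; rewrite /mu /= /counting; case: ifPn => [/asboolP finA|/asboolP infA].
  apply: (H (fset_set A)) => [|y]; first exact: fset_uniq.
  by rewrite in_fset_set // => /set_mem.
have {H} K_ge n : n%:R%:E <= K.
  have [B BA nB] := infinite_set_fset n infA.
  apply: le_trans (H (enum_fset B) (fset_uniq B) _); first by rewrite lee_fin ler_nat.
  by move=> y yB; apply: BA.
case: K K_ge => [k| |] K_ge; last by have := K_ge 0%N.
- have := K_ge (Num.truncn k).+1; rewrite lee_fin leNgt.
  by rewrite truncnS_gt.
- exact: leey.
Qed.

Lemma integral_seq_mu s (g : V -> R) : uniq s -> (forall y, 0 <= g y)%R ->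
  \int[mu R]_(y in [set y | y \in s]) (g y)%:E = (\sum_(y <- s) g y)%R%:E.
Proof.
move=> us g0.
have -> : [set y | y \in s] = \big[setU/set0]_(y <- s) [set y].
  apply/seteqP; split => y; rewrite -bigcup_seq /=.
    by move=> ys; exists y.
  by move=> [z zs ->].
rewrite ge0_integral_bigsetU //=; last 2 first.
- by move=> i j _ _ [y [-> ->]].
- by move=> y _; rewrite lee_fin.
rewrite -sumEFin; apply: eq_bigr => y _.
rewrite (eq_integral (cst (g y)%:E)); last by move=> z /set_mem ->.
rewrite integral_cst //= /mu /= /counting asboolT; last exact: finite_set1.
by rewrite fset_set1 cardfs1 mule1.
Qed.

Lemma sum_seq_le_integral s (g : V -> R) : uniq s -> (forall y, 0 <= g y)%R ->
  (\sum_(y <- s) g y)%R%:E <= \int[mu R]_y (g y)%:E.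
Proof.
move=> us g0; rewrite -integral_seq_mu //.
by apply: ge0_subset_integral => //= y _; rewrite lee_fin.
Qed.

End CountingMeasure.

(** * Geometric sums *)

Section GeometricSums.
Context {R : realType}.
Implicit Types (q a c u X : R) (n N K : nat).

Lemma geo_sum_le q N : 0 <= q -> q < 1 -> \sum_(n < N) q ^+ n <= (1 - q)^-1.
Proof.
move=> q0 q1; have d0 : 0 < 1 - q by rewrite subr_gt0.
rewrite -[leRHS]mul1r ler_pdivlMr //.
have -> : (\sum_(n < N) q ^+ n) * (1 - q) = 1 - q ^+ N.
  by rewrite -[1 - q ^+ N]opprB subrX1; ring.
by rewrite gerBl exprn_ge0.
Qed.

(** The largest summand is at most [X] and the others decay geometrically from
it. *)
Lemma geo_sum_small q X N : 0 < q -> q < 1 -> 0 <= X ->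
  \sum_(n < N) (if q ^+ n <= X then q ^+ n else 0) <= X / (1 - q).
Proof.
move=> q0 q1; have d0 : 0 < 1 - q by rewrite subr_gt0.
elim: N X => [|N IH] X X0; first by rewrite big_ord0 divr_ge0 // ltW.
have [X1|X1] := leP 1 X.
  apply: (@le_trans _ _ (\sum_(n < N.+1) q ^+ n)).
    by apply: ler_sum => n _; case: ifP => // _; rewrite exprn_ge0 // ltW.
  apply: le_trans (geo_sum_le _ (ltW q0) q1) _.
  by rewrite ler_peMl // invr_ge0 ltW.
rewrite big_ord_recl expr0 ifF ?add0r; last by rewrite leNgt X1.
have -> : X / (1 - q) = q * ((X / q) / (1 - q)) by field; lra.
rewrite (eq_bigr (fun n : 'I_N => q * (if q ^+ n <= X / q then q ^+ n else 0))).
  by rewrite -mulr_sumr ler_pM2l // IH // divr_ge0 // ltW.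
move=> n _; rewrite lift0 exprS ler_pdivlMr // mulrC.
by case: ifP => // _; rewrite ?mulr0 // mulrC.
Qed.

Lemma geo_sum_large a X N : 1 < a -> 0 <= X ->
  \sum_(n < N) (if a ^+ n <= X then a ^+ n else 0) <= X * (1 - a^-1)^-1.
Proof.
move=> a1 X0; have a0 : 0 < a by lra.
have d0 : 0 < 1 - a^-1 by rewrite subr_gt0 invf_lt1.
elim: N => [|N IH]; first by rewrite big_ord0 mulr_ge0 // invr_ge0 ltW.
rewrite big_ord_recr /=; case: ifP => [aX|_]; last by rewrite addr0.
apply: (@le_trans _ _ (\sum_(n < N.+1) a ^+ n)).
  rewrite big_ord_recr /= lerD2r; apply: ler_sum => n _; case: ifP => // _.
  by rewrite exprn_ge0 // ltW.
rewrite (reindex_inj rev_ord_inj) /=.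
rewrite (eq_bigr (fun n : 'I_N.+1 => a ^+ N * a^-1 ^+ n)); last first.
  move=> n _; rewrite subSS exprVn; apply: (@mulIf _ (a ^+ n)).
    by rewrite expf_neq0 // gt_eqF.
  rewrite -exprD subnK -?mulrA ?mulVf ?mulr1 // ?expf_neq0 ?gt_eqF //.
  by rewrite -ltnS.
rewrite -mulr_sumr; apply: le_trans (_ : a ^+ N * (1 - a^-1)^-1 <= _); last first.
  by rewrite ler_wpM2r // invr_ge0 ltW.
rewrite ler_wpM2l ?exprn_ge0 ?(ltW a0) //.
by rewrite geo_sum_le ?invr_ge0 ?(ltW a0) ?invf_lt1.
Qed.

(** The total charge received by a point where the function has value [u],
summed over all distances [k] and descent lengths [p]. With
[B k = \sum_(p heavy) a ^- p], the contribution of [k] is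
[min (a ^+ k) (2 * u) * B k]. The sum [B k] is bounded by a constant, and also,
since heaviness reads [a ^- p < sqrt (u / (c * a ^+ k))], by a multiple of this
square root. The first bound serves for [a ^+ k <= u]; the second one makes the
terms with [a ^+ k > u] decay like [u * sqrt (u / a ^+ k)]. Both ranges of [k]
are geometric sums bounded by a multiple of [u]. *)
Lemma sum_heavy_le a c : 1 < a -> 0 < c -> exists2 C : R, 0 < C &
  forall u K, 0 <= u ->
    \sum_(k < K) \sum_(p < k.+1)
      (if c * a ^+ k < u * a ^+ p ^+ 2
       then Num.min 1 (2 * u / a ^+ k) * a ^+ (k - p) else 0) <= C * u.
Proof.
move=> a1 c0; have a0 : 0 < a by lra.
pose s := Num.sqrt a; pose t := s^-1; pose D := (1 - a^-1)^-1.
have s1 : 1 < s by rewrite -sqrtr1 ltr_sqrt.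
have s0 : 0 < s by lra.
have sq_s : s ^+ 2 = a by rewrite sqr_sqrtr ?ltW.
have t0 : 0 < t by rewrite invr_gt0.
have t1 : t < 1 by rewrite invf_lt1.
have sq_t : t ^+ 2 = a^-1 by rewrite exprVn sq_s.
have ia0 : 0 < a^-1 by rewrite invr_gt0.
have ia1 : a^-1 < 1 by rewrite invf_lt1.
have D0 : 0 < D by rewrite invr_gt0 subr_gt0.
have sc0 : 0 < Num.sqrt c by rewrite sqrtr_gt0.
exists (D * D + 2 * D / Num.sqrt c / (1 - t)).
  by rewrite addr_gt0 ?mulr_gt0 // ?invr_gt0 // subr_gt0.
move=> u K u0.
have an0 n : 0 < a ^+ n by rewrite exprn_gt0.
have [->|un0] := eqVneq u 0.
  rewrite [leRHS]mulr0 big1 // => k _; rewrite big1 // => p _.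
  by rewrite mul0r ltNge ltW // mulr_gt0.
have {un0}u0 : 0 < u by rewrite lt_neqAle eq_sym un0.
have su0 : 0 < Num.sqrt u by rewrite sqrtr_gt0.
have sq_u : Num.sqrt u ^+ 2 = u by rewrite sqr_sqrtr ?ltW.
have sq_c : Num.sqrt c ^+ 2 = c by rewrite sqr_sqrtr ?ltW.
pose B k := \sum_(p < k.+1) (if c * a ^+ k < u * a ^+ p ^+ 2 then a^-1 ^+ p else 0).
have BD k : B k <= D.
  apply: le_trans (geo_sum_le k.+1 (ltW ia0) ia1); apply: ler_sum => p _.
  by case: ifP => // _; rewrite exprn_ge0 // ltW.
have Bsqrt k : B k <= Num.sqrt u / Num.sqrt c * t ^+ k * D.
  have X0 : 0 <= Num.sqrt u / Num.sqrt c * t ^+ k.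
    by rewrite !mulr_ge0 ?invr_ge0 ?exprn_ge0 // ltW.
  apply: le_trans (geo_sum_small k.+1 ia0 ia1 X0); apply: ler_sum => p _.
  case: ifP => bad; last by case: ifP => // _; rewrite exprn_ge0 // ltW.
  rewrite ifT // -(ler_pXn2r (n := 2)) ?nnegrE ?exprn_ge0 ?(ltW ia0) //.
  rewrite [leRHS]exprMn (exprAC t) sq_t exprMn sq_u !exprVn sq_c.
  rewrite -mulrA -invfM ler_pdivlMr ?mulr_gt0 // mulrC.
  by rewrite ler_pdivrMr ?exprn_gt0 // ltW.
have B0 k : 0 <= B k.
  by rewrite sumr_ge0 // => p _; case: ifP => // _; rewrite exprn_ge0 // ltW.
have u20 : 0 <= 2 * u by rewrite mulr_ge0 // ltW.
have term k : \sum_(p < k.+1)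
      (if c * a ^+ k < u * a ^+ p ^+ 2
       then Num.min 1 (2 * u / a ^+ k) * a ^+ (k - p) else 0)
    = Num.min (a ^+ k) (2 * u) * B k.
  rewrite mulr_sumr; apply: eq_bigr => p _; case: ifP => _; last by rewrite mulr0.
  have -> : a ^+ (k - p) = a ^+ k * a^-1 ^+ p.
    rewrite exprVn; apply: (@mulIf _ (a ^+ p)); first by rewrite gt_eqF.
    by rewrite -exprD subnK ?mulfVK ?gt_eqF // -ltnS.
  rewrite mulrA minr_pMl ?(ltW (an0 _)) // mul1r mulfVK // gt_eqF //.
under eq_bigr do rewrite term.
(* [a ^+ k > u] is rewritten as [t ^+ k < 1 / sqrt u] with [t = 1 / sqrt a], to
   match the shape of geo_sum_small. *)
apply: (@le_trans _ _ (\sum_(k < K) (D * (if a ^+ k <= u then a ^+ k else 0) +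
   2 * u * D * Num.sqrt u / Num.sqrt c *
     (if t ^+ k <= (Num.sqrt u)^-1 then t ^+ k else 0)))).
  apply: ler_sum => k _; have [au|ua] := leP (a ^+ k) u.
    rewrite (@le_trans _ _ (D * a ^+ k)) //.
      by rewrite mulrC ler_pM ?BD ?B0 // ?le_min ?ge_min ?lexx ?(ltW (an0 _)) ?u20.
    rewrite lerDl mulr_ge0 //; first by rewrite ltW // divr_gt0 // !mulr_gt0.
    by case: ifP => // _; rewrite exprn_ge0 // ltW.
  rewrite mulr0 add0r ifT; last first.
    rewrite exprVn lef_pV2 ?posrE ?exprn_gt0 // -(ler_pXn2r (n := 2)) ?nnegrE ?exprn_ge0 ?(ltW s0) ?(ltW su0) //.
    by rewrite sq_u exprAC sq_s ltW.
  apply: (@le_trans _ _ (2 * u * (Num.sqrt u / Num.sqrt c * t ^+ k * D))).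
    by rewrite ler_pM ?Bsqrt ?B0 // ?le_min ?ge_min ?lexx ?orbT ?(ltW (an0 _)) ?u20.
  by rewrite le_eqVlt; apply/orP; left; apply/eqP; ring.
rewrite big_split /= -!mulr_sumr [leRHS]mulrDl; apply: lerD.
  rewrite -mulrA ler_pM2l // mulrC; apply: geo_sum_large => //; exact: ltW.
have -> : 2 * D / Num.sqrt c / (1 - t) * u =
   2 * u * D * Num.sqrt u / Num.sqrt c * ((Num.sqrt u)^-1 / (1 - t)).
  by field; rewrite !gt_eqF // subr_gt0.
rewrite ler_pM2l; last by rewrite divr_gt0 // !mulr_gt0.
by apply: geo_sum_small => //; rewrite invr_ge0 ltW.
Qed.

End GeometricSums.

(** * The charging argument *)

Section ChargingArgument.
Context {R : realType} {V : eqType}.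

(** Subadditivity of [min 1]: bounds on truncated terms add up. *)
Lemma min1_sum (I : Type) (r : seq I) (P : pred I) (f g : I -> R) :
  (forall i, P i -> 0 <= f i /\ Num.min 1 (f i) <= g i) ->
  0 <= \sum_(i <- r | P i) f i /\
  Num.min 1 (\sum_(i <- r | P i) f i) <= \sum_(i <- r | P i) g i.
Proof.
move=> H; elim/big_rec2: _ => [|i x y Pi [y0 ih]]; first by rewrite ge_min lexx orbT.
have [fi0 fg] := H i Pi; split; first by rewrite addr_ge0.
move: fg ih; rewrite !minEle.
by case: (leP 1 (f i)); case: (leP 1 y); case: (leP 1 (f i + y)) => /=; lra.
Qed.

Variables (a B : R).
Hypotheses (a1 : 1 < a) (B0 : 0 < B).
Variables (linked : nat -> V -> V -> bool) (descends : nat -> nat -> V -> V -> bool).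
Hypothesis linked_descends : forall k x y, linked k x y ->
  exists2 p, (p <= k)%N & descends k p x y.
Hypothesis descends_target : forall k p x (s : seq V), uniq s ->
  (count (descends k p x) s)%:R <= B * a ^+ p.
Hypothesis descends_source : forall k p y (s : seq V), uniq s ->
  (count (descends k p ^~ y) s)%:R <= B * a ^+ (k - p).

(** The relation [linked k] is covered by the relations [descends k p] with
[p <= k], which have few targets when [p] is small and few sources when [k - p]
is small. Call [y] heavy for [(k, p)] when [c * a ^+ k < h y * a ^+ (2 * p)]. At a
point [x] of [F] with its distance [k], light points contribute at most
[\sum_p (B * a ^+ p) * (c * a ^+ (k - 2 * p)) <= a ^+ k / 2], by counting
targets. The heavy points then carry [a ^+ k / 2], so their truncated weights
[min 1 (2 * h y / a ^+ k)] sum to at least 1. Adding this over [x] in [F] and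
over all [k], and counting sources for each heavy [y], bounds [size F] by the
charges of [sum_heavy_le]. The truncation is what makes the sum over the [k]
with [a ^+ k <= h y] converge to [O (h y)]. *)
Lemma weak_type_charging : exists2 C : R, 0 < C &
  forall (F Y : seq V) (h : V -> R), uniq F -> uniq Y -> (forall y, 0 <= h y) ->
  (forall x, x \in F -> exists k, a ^+ k < \sum_(y <- Y | linked k x y) h y) ->
  (size F)%:R <= C * \sum_(y <- Y) h y.
Proof.
have a0 : 0 < a by exact: lt_trans ltr01 a1.
have an0 n : 0 < a ^+ n by rewrite exprn_gt0.
have ia0 : 0 < a^-1 by rewrite invr_gt0.
have ia1 : a^-1 < 1 by rewrite invf_lt1.
pose D := (1 - a^-1)^-1; have D0 : 0 < D by rewrite invr_gt0 subr_gt0.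
(* Chosen so that [B * c * D = 1 / 2] in the bound for light points. *)
pose c := (2 * B * D)^-1.
have c0 : 0 < c by rewrite invr_gt0 !mulr_gt0.
have [C C0 HC] := sum_heavy_le a1 c0.
exists (B * C); first exact: mulr_gt0.
move=> F Y h uF uY h0 HF.
pose heavy k p y := c * a ^+ k < h y * a ^+ p ^+ 2.
pose w k y := Num.min 1 (2 * h y / a ^+ k).
have w0 k y : 0 <= w k y.
  by rewrite le_min ler01 divr_ge0 ?(ltW (an0 _)) // mulr_ge0.
have point x : x \in F -> exists k, 1 <= \sum_(p < k.+1) \sum_(y <- Y)
    (if descends k p x y && heavy k p y then w k y else 0).
  move=> /HF[k Hk]; exists k.
  have cover : \sum_(y <- Y | linked k x y) h y <=
      \sum_(p < k.+1) \sum_(y <- Y | descends k p x y) h y.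
    under [leRHS]eq_bigr do rewrite big_mkcond.
    rewrite [leRHS]exchange_big /= big_mkcond; apply: ler_sum => y _.
    case: ifP => [/linked_descends[p ple chp]|_]; last first.
      by rewrite sumr_ge0 // => p _; case: ifP.
    rewrite (bigD1 (Ordinal (ple : (p < k.+1)%N))) //= chp lerDl.
    by rewrite sumr_ge0 // => q _; case: ifP.
  have light_sum : \sum_(p < k.+1) \sum_(y <- Y | descends k p x y && ~~ heavy k p y) h y
      <= a ^+ k / 2.
    apply: (@le_trans _ _ (\sum_(p < k.+1) B * c * a ^+ k * a^-1 ^+ p)); last first.
      rewrite -mulr_sumr.
      have -> : a ^+ k / 2 = B * c * a ^+ k * D.
        by rewrite /c; field; rewrite !gt_eqF.
      by rewrite ler_pM2l ?mulr_gt0 //; apply: geo_sum_le => //; exact: ltW.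
    apply: ler_sum => p _.
    apply: (@le_trans _ _
        (\sum_(y <- Y | descends k p x y) c * a ^+ k / a ^+ p ^+ 2)).
      rewrite big_mkcond [leRHS]big_mkcond; apply: ler_sum => y _.
      case: (descends k p x y) => //=; case: ifPn => [|_].
        by rewrite -leNgt ler_pdivlMr // exprn_gt0.
      by rewrite divr_ge0 ?mulr_ge0 ?exprn_ge0 // ltW.
    rewrite big_const_seq iter_addr_0 -mulr_natr.
    apply: (@le_trans _ _ (c * a ^+ k / a ^+ p ^+ 2 * (B * a ^+ p))).
      by rewrite ler_wpM2l ?descends_target // divr_ge0 ?mulr_ge0 ?exprn_ge0 // ltW.
    by rewrite le_eqVlt exprVn; apply/orP; left; apply/eqP; field; rewrite gt_eqF.
  have heavy_sum : 1 <= \sum_(p < k.+1)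
      \sum_(y <- Y | descends k p x y && heavy k p y) 2 * h y / a ^+ k.
    have : a ^+ k / 2 <= \sum_(p < k.+1)
        \sum_(y <- Y | descends k p x y && heavy k p y) h y.
      have : \sum_(p < k.+1) \sum_(y <- Y | descends k p x y) h y =
          \sum_(p < k.+1) \sum_(y <- Y | descends k p x y && heavy k p y) h y +
          \sum_(p < k.+1) \sum_(y <- Y | descends k p x y && ~~ heavy k p y) h y.
        rewrite -big_split /=; apply: eq_bigr => p _.
        by rewrite (bigID (heavy k p)).
      lra.
    move=> H; have -> : \sum_(p < k.+1)
        \sum_(y <- Y | descends k p x y && heavy k p y) 2 * h y / a ^+ k =
      2 / a ^+ k * \sum_(p < k.+1)
        \sum_(y <- Y | descends k p x y && heavy k p y) h y.
      rewrite mulr_sumr; apply: eq_bigr => p _.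
      by rewrite mulr_sumr; apply: eq_bigr => y _; rewrite mulrAC.
    have one : (1 : R) = 2 / a ^+ k * (a ^+ k / 2) by field; rewrite gt_eqF.
    by rewrite [leLHS]one ler_pM2l // divr_gt0.
  under eq_bigr do rewrite -big_mkcond.
  have [_] := @min1_sum _ (index_enum 'I_k.+1) xpredT
    (fun p => \sum_(y <- Y | descends k p x y && heavy k p y) 2 * h y / a ^+ k)
    (fun p => \sum_(y <- Y | descends k p x y && heavy k p y) w k y)
    (fun p _ => @min1_sum _ Y _ _ _ (fun y _ =>
       conj (divr_ge0 (mulr_ge0 (ler0n R 2) (h0 y)) (ltW (an0 k))) (lexx _))).
  by rewrite min_l.
pose term k p x y := if descends k p x y && heavy k p y then w k y else 0.
have term0 k p x y : 0 <= term k p x y by rewrite /term; case: ifP.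
have {}point x : exists k, x \in F ->
    1 <= \sum_(p < k.+1) \sum_(y <- Y) term k p x y.
  by have [/point[k Hk]|] := boolP (x \in F); [exists k|exists 0%N].
have [kap Hkap] := choice point.
(* The distances chosen for the finitely many points of [F] are bounded, so that
   the sum over [k] is finite. *)
pose K := (\max_(x <- F) kap x).+1.
have kapK x : x \in F -> (kap x < K)%N.
  by move=> xF; rewrite ltnS; apply: leq_bigmax_seq.
apply: (@le_trans _ _ (\sum_(x <- F) \sum_(k < K) \sum_(p < k.+1)
   \sum_(y <- Y) term k p x y)).
  rewrite -sum1_size natr_sum big_seq [leRHS]big_seq; apply: ler_sum => x xF.
  apply: le_trans (Hkap x xF) _.
  rewrite (bigD1 (Ordinal (kapK x xF))) //= lerDl.
  by do 3 (rewrite sumr_ge0 // => ? _).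
rewrite exchange_big /=.
apply: (@le_trans _ _ (\sum_(k < K) \sum_(p < k.+1) \sum_(y <- Y)
   B * (if heavy k p y then w k y * a ^+ (k - p) else 0))).
  apply: ler_sum => k _; rewrite exchange_big /=; apply: ler_sum => p _.
  rewrite exchange_big /=; apply: ler_sum => y _; rewrite /term.
  case: (heavy k p y); last by rewrite mulr0 big1 // => x _; rewrite andbF.
  under eq_bigr do rewrite andbT.
  rewrite -big_mkcond big_const_seq iter_addr_0 -mulr_natr.
  rewrite mulrCA ler_wpM2l //; exact: descends_source.
under [leLHS]eq_bigr do rewrite exchange_big /=.
rewrite exchange_big mulr_sumr /=; apply: ler_sum => y _.
under [leLHS]eq_bigr do rewrite -mulr_sumr.
by rewrite -mulr_sumr -mulrA ler_pM2l //; apply: HC.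
Qed.

End ChargingArgument.

(** * From balls to spheres *)

Section Reduction.
Context {R : realType} {V : pointedType}.
Variables (e : rel V) (alpha c1 c2 : R).
Hypotheses (alpha1 : 1 < alpha) (c1_gt0 : 0 < c1).
Hypothesis sphere_bounds : forall (x : V) (r : nat),
  ((c1 * alpha ^+ r)%:E <= mu R (gsphere e x r))%E /\
  (mu R (gsphere e x r) <= (c2 * alpha ^+ r)%:E)%E.

Lemma finite_gball x r : finite_set (gball e x r).
Proof.
have -> : gball e x r = \bigcup_(k in `I_r.+1) gsphere e x k.
  apply/seteqP; split => y /=; last by move=> [k /= kr dk]; rewrite /gball /= dk.
  by move=> yB; exists (gdist e x y).
apply: bigcup_finite => // k _; apply: contrapT => inf.
by have [_] := sphere_bounds x k; rewrite /mu /= /counting asboolF.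
Qed.

(** A ball of radius [r] has at least [c1 * alpha ^+ r] points, so a large mean
over it makes the sum over the ball exceed [lambda * c1 * alpha ^+ r]. If every
sphere were below the stated threshold, the geometric sum over the radii
[k <= r] would contradict this. The sum is taken over any sequence containing
the ball, to allow one sequence for several points [x]. *)
Lemma maximal_gt_sphere (f : V -> R) (lambda : R) x : 0 < lambda ->
  (lambda%:E < maximal e f x)%E ->
  exists r, forall Y : seq V, uniq Y -> (forall y, gball e x r y -> y \in Y) ->
    exists k, lambda * c1 * (1 - alpha^-1) * alpha ^+ k <
              \sum_(y <- Y | gdist e x y == k) `|f y|.
Proof.
move=> l0 /ereal_sup_gt[_ [r _ <-] avg]; exists r => Y uY YB.
apply: contrapT => /forallNP none.
have a0 : 0 < alpha by exact: lt_trans ltr01 alpha1.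
have d0 : 0 < 1 - alpha^-1 by rewrite subr_gt0 invf_lt1.
pose s := [seq y <- Y | (gdist e x y <= r)%N].
have us : uniq s by exact: filter_uniq.
have sB : gball e x r = [set y | y \in s].
  apply/seteqP; split => y /=; rewrite mem_filter; first by move=> yB; rewrite yB YB.
  by case/andP.
have size_s : c1 * alpha ^+ r <= (size s)%:R.
  rewrite -lee_fin; apply: le_trans (proj1 (sphere_bounds x r)) _.
  apply: mu_le_seq => t ut tS; rewrite lee_fin ler_nat; apply: uniq_leq_size => //.
  by move=> y /tS yr; rewrite mem_filter yr leqnn YB //= /gball /= yr.
have s0 : 0 < (size s)%:R :> R by apply: lt_le_trans size_s; rewrite mulr_gt0 // exprn_gt0.
move: avg; rewrite sB integral_seq_mu //.
have -> : mu R [set y | y \in s] = (size s)%:R%:E.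
  apply/eqP; rewrite eq_le seq_size_le_mu // andbT; apply: mu_le_seq => t ut ts.
  by rewrite lee_fin ler_nat uniq_leq_size.
rewrite inver gt_eqF // -EFinM lte_fin mulrC ltr_pdivlMr // ltNge.
case/negP.
apply: (@le_trans _ _ (lambda * c1 * alpha ^+ r)); last first.
  by rewrite -mulrA ler_pM2l.
rewrite big_filter.
apply: (@le_trans _ _ (\sum_(k < r.+1) \sum_(y <- Y | gdist e x y == k) `|f y|)).
  under [leRHS]eq_bigr do rewrite big_mkcond.
  rewrite [leRHS]exchange_big /= big_mkcond; apply: ler_sum => y _.
  case: ifP => [dr|_]; last by rewrite sumr_ge0 // => k _; case: ifP.
  rewrite (bigD1 (Ordinal (dr : (gdist e x y < r.+1)%N))) //= eqxx lerDl.
  by rewrite sumr_ge0 // => k _; case: ifP.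
apply: (@le_trans _ _ (\sum_(k < r.+1) lambda * c1 * (1 - alpha^-1) * alpha ^+ k)).
  by apply: ler_sum => k _; rewrite leNgt; apply/negP; apply: none.
rewrite -mulr_sumr.
have geo : \sum_(k < r.+1) alpha ^+ k <= alpha ^+ r * (1 - alpha^-1)^-1.
  apply: le_trans (geo_sum_large r.+1 alpha1 (exprn_ge0 r (ltW a0))).
  apply: ler_sum => k _; rewrite ler_eXn2l // -ltnS ltn_ord //.
apply: le_trans (_ : lambda * c1 * (1 - alpha^-1) *
    (alpha ^+ r * (1 - alpha^-1)^-1) <= _).
  by rewrite ler_pM2l // !mulr_gt0.
by rewrite le_eqVlt; apply/orP; left; apply/eqP; field; rewrite !gt_eqF // subr_gt0.
Qed.

End Reduction.

(** * The weak type inequality *)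

Theorem theorem3p6 (R : realType) (V : pointedType) (e : rel V) (a b : nat)
    (ha : (2 <= a)%N) (hab : (a < b)%N) (he : Upsilon a b e)
    (hgrowth : exists alpha c1 c2 : R,
      [/\ 0 < alpha, 0 < c1, 0 < c2 &
          forall (x : V) (r : nat),
            ((c1 * alpha ^+ r)%:E <= mu R (gsphere e x r))%E /\
            (mu R (gsphere e x r) <= (c2 * alpha ^+ r)%:E)%E]) :
  weak_type11 (maximal (R := R) e).
Proof.
have [treeE fin val _ _] := he.
have [alpha [c1 [c2 [alpha0 c10 c20 bounds]]]] := hgrowth.
have sphere_seq x r (s : seq V) : uniq s -> (forall y, y \in s -> gdist e x y = r) ->
    (size s)%:R <= c2 * alpha ^+ r.
  move=> us sr; rewrite -lee_fin; apply: le_trans (proj2 (bounds x r)).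
  exact: seq_size_le_mu.
have alpha1 : 1 < alpha.
  rewrite ltNge; apply/negP => alpha_le1.
  pose r := (Num.truncn c2).+1.
  have val3 x : (2 < valence e x)%N by have /andP[] := val x; lia.
  have [s [us ss sr]] := sphere_growth treeE point fin val3 r.
  have := sphere_seq _ _ _ us sr; rewrite ss leNgt => /negP; apply.
  apply: (@le_lt_trans _ _ c2); first by rewrite ler_piMr ?exprn_ile1 // ltW.
  apply: (lt_le_trans (truncnS_gt c2)); rewrite ler_nat ltnW //.
  exact: ltn_expl.
have [pi [step orient _ _]] := tree_parent treeE point.
pose linked k (x y : V) := gdist e x y == k.
pose descends k p x y := (gdist e (iter (k - p) pi x) y == p) &&
                         (gdist e (iter p pi y) x == (k - p)%N).
have linked_descends k x y : linked k x y -> exists2 p, (p <= k)%N & descends k p x y.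
  move=> /eqP/(gdist_peak treeE step orient)[p pk [d1 d2]].
  by exists p => //; rewrite /descends d1 d2 !eqxx.
have target k p x (s : seq V) : uniq s ->
    (count (descends k p x) s)%:R <= c2 * alpha ^+ p.
  move=> us; rewrite -size_filter; apply: (sphere_seq (iter (k - p) pi x)).
    exact: filter_uniq.
  by move=> y; rewrite mem_filter => /andP[/andP[/eqP]].
have source k p y (s : seq V) : uniq s ->
    (count (descends k p ^~ y) s)%:R <= c2 * alpha ^+ (k - p).
  move=> us; rewrite -size_filter; apply: (sphere_seq (iter p pi y)).
    exact: filter_uniq.
  by move=> x; rewrite mem_filter => /andP[/andP[_ /eqP]].
have [C C0 weak] := weak_type_charging alpha1 c20 linked_descends target source.
have d0 : 0 < c1 * (1 - alpha^-1) by rewrite mulr_gt0 // subr_gt0 invf_lt1.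
exists (C / (c1 * (1 - alpha^-1))) => f lambda _ l0.
apply: mu_le_seq => F uF FM.
have /choice[rad Hrad] : forall x, exists r, x \in F ->
    forall Y : seq V, uniq Y -> (forall y, gball e x r y -> y \in Y) ->
    exists k, lambda * c1 * (1 - alpha^-1) * alpha ^+ k <
              \sum_(y <- Y | gdist e x y == k) `|f y|.
  move=> x; have [/FM xM|_] := boolP (x \in F); last by exists 0%N.
  by have [r Hr] := maximal_gt_sphere alpha1 c10 bounds l0 xM; exists r.
pose Y := undup (flatten [seq enum_fset (fset_set (gball e x (rad x))) | x <- F]).
have YB x y : x \in F -> gball e x (rad x) y -> y \in Y.
  move=> xF yB; rewrite mem_undup; apply/flatten_mapP; exists x => //.
  by rewrite in_fset_set ?inE //; exact: finite_gball bounds _ _.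
pose m := lambda * c1 * (1 - alpha^-1).
have m0 : 0 < m by rewrite /m -mulrA mulr_gt0.
have size_F : (size F)%:R <= C * \sum_(y <- Y) `|f y| / m.
  apply: weak => // [|y|x xF]; first exact: undup_uniq.
    by rewrite divr_ge0 // ltW.
  have [k Hk] := Hrad x xF Y (undup_uniq _) (YB x ^~ xF); exists k.
  by rewrite -mulr_suml ltr_pdivlMr // mulrC.
have -> : (C / (c1 * (1 - alpha^-1)) / lambda)%:E = (C / m)%:E.
  by congr EFin; rewrite /m; field; rewrite !gt_eqF // subr_gt0.
apply: (@le_trans _ _ ((C / m)%:E * (\sum_(y <- Y) `|f y|)%:E)%E).
  by rewrite -EFinM lee_fin (le_trans size_F) // -mulr_suml mulrA mulrAC.
rewrite lee_pmul2l ?lte_fin ?divr_gt0 //.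
exact: sum_seq_le_integral (undup_uniq _) _.
Qed.
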